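(* Let $K$ be a pathwise connected poset and let $\mathfrak{C}=(C,r)^K$ be a presheaf of $C^*$-categories over $K$. Then there is a canonical morphism $P:{}_\beta\mathfrak{C}\to\mathfrak{C}$ of presheaves of $C^*$-categories such that ${}_\beta\mathfrak{C}=({}_\beta C,{}_\beta r)^K$ is a presheaf bundle and the induced $*$-functor $\widetilde P:\widetilde{{}_\beta\mathfrak{C}}\to\widetilde{\mathfrak{C}}$ between the section categories is an isomorphism.
   Context: A poset $K$ is pathwise connected if any two elements are joined by a finite sequence of triples $b=(\partial_0b,\partial_1b;|b|)$ of elements of $K$ with $\partial_0b,\partial_1b\le|b|$, the $\partial_0$ of each being the $\partial_1$ of the next. A $C^*$-category has Banach spaces of arrows $(\rho,\sigma)$, bilinear composition, an involution $*:(\rho,\sigma)\to(\sigma,\rho)$ and satisfies $\|t^*\circ t\|=\|t\|^2$. A presheaf of $C^*$-categories $\mathfrak{C}=(C,r)^K$ is a family of $C^*$-categories $C_o$, $o\in K$, with $*$-functors $r_{oo'}:C_{o'}\to C_o$, $o\le o'$, which are embeddings (injective on each set of arrows) and satisfy $r_{oo'}\circ r_{o'o''}=r_{oo''}$ for $o\le o'\le o''$. It is a presheaf bundle if every $r_{oo'}$ is an isomorphism of categories (bijective on objects and on arrows). The section category $\widetilde{\mathfrak{C}}$ is the $C^*$-category with objects the families $\varrho=\{\varrho_o\in\mathrm{obj}\,C_o\}_{o\in K}$ with $r_{oo'}(\varrho_{o'})=\varrho_o$ for all $o\le o'$, arrows $(\varrho,\varsigma)$ the families $t=\{t_o\in(\varrho_o,\varsigma_o)\}_{o\in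 K}$ with $r_{oo'}(t_{o'})=t_o$ for all $o\le o'$, fibrewise operations, and norm $\|t\|=\sup_o\|t_o\|$. A morphism $P:\mathfrak{C}'\to\mathfrak{C}$ of presheaves of $C^*$-categories is a family of $*$-functors $P_o:C'_o\to C_o$ with $r_{oo'}\circ P_{o'}=P_o\circ r'_{oo'}$, $o\le o'$; it induces $\widetilde P:\widetilde{\mathfrak{C}'}\to\widetilde{\mathfrak{C}}$, $\widetilde P(\varrho)=\{P_o(\varrho_o)\}$, $\widetilde P(t)=\{P_o(t_o)\}$. ''Canonical'' means constructed from $\mathfrak{C}$ without choices. *)

(* Defs.v *)
From HB Require Import structures.
From mathcomp Require Import all_boot all_order all_algebra.
From mathcomp Require Import complex.
From mathcomp Require Import boolp classical_sets functions reals.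
From mathcomp Require Import topology normedtype.

Set Implicit Arguments.
Unset Strict Implicit.
Unset Printing Implicit Defensive.

Import Order.TTheory GRing.Theory Num.Theory.
Local Open Scope ring_scope.
Local Open Scope classical_set_scope.
Local Open Scope complex_scope.

Record simplex1 (d : Order.disp_t) (K : porderType d) := Simplex1 {
  face0 : K;
  face1 : K;
  supp : K;
  face0_le : (face0 <= supp)%O;
  face1_le : (face1 <= supp)%O }.

Fixpoint is_path (d : Order.disp_t) (K : porderType d)
    (a : K) (p : seq (simplex1 K)) (a' : K) : Prop :=
  match p with
  | [::] => a = a'
  | b :: p' => face1 b = a /\ is_path (face0 b) p' a'
  end.

Definition pathwise_connected (d : Order.disp_t) (K : porderType d) : Prop :=
  forall a a' : K, exists p : seq (simplex1 K), is_path a p a'.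

Definition order_isomorphism (d d' : Order.disp_t)
    (K : porderType d) (L : porderType d') (f : K -> L) : Prop :=
  bijective f /\ {mono f : x y / (x <= y)%O}.

(** [hom x y] is the space of arrows from [x] to [y], written (x,y).  The
    function [hnorm] carries no axiom here, so that the section category below
    can be formed before one knows that its norm is finite. *)
Record starCat (R : realType) := StarCat {
  obj :> Type;
  hom : obj -> obj -> lmodType R[i];
  hnorm : forall x y, hom x y -> R;
  idm : forall x, hom x x;
  comp : forall x y z, hom y z -> hom x y -> hom x z;
  star : forall x y, hom x y -> hom y x;
  comp1m : forall x y (t : hom x y), comp (idm y) t = t;
  compm1 : forall x y (t : hom x y), comp t (idm x) = t;
  compA : forall x y z w (u : hom z w) (t : hom y z) (s : hom x y),
    comp u (comp t s) = comp (comp u t) s;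
  comp_linl : forall x y z (s : hom x y),
    linear (fun t : hom y z => comp t s);
  comp_linr : forall x y z (t : hom y z),
    linear (fun s : hom x y => comp t s);
  star_antilinear : forall x y (a : R[i]) (s t : hom x y),
    star (a *: s + t) = a^* *: star s + star t;
  starK : forall x y (t : hom x y), star (star t) = t;
  star_comp : forall x y z (t : hom y z) (s : hom x y),
    star (comp t s) = comp (star s) (star t) }.

Arguments hom {R} _ _ _.
Arguments hnorm {R _ x y} _.
Arguments idm {R _} _.
Arguments comp {R _ x y z} _ _.
Arguments star {R _ x y} _.

(** [N] is the norm of a Banach space; the library's norm on a complex normed
    space takes its (real) values in [R[i]]. *)
Definition banach_norm (R : realType) (V : lmodType R[i]) (N : V -> R) : Prop :=
  exists (B : completeNormedModType R[i]) (f : V -> B),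
    [/\ linear f, bijective f & forall v, `|f v| = (N v)%:C].

Record is_Cstar (R : realType) (C : starCat R) : Prop := IsCstar {
  hom_banach : forall x y : C, banach_norm (fun t : hom C x y => hnorm t);
  hnorm_comp : forall (x y z : C) (t : hom C y z) (s : hom C x y),
    hnorm (comp t s) <= hnorm t * hnorm s;
  hnorm_star : forall (x y : C) (t : hom C x y),
    hnorm (comp (star t) t) = hnorm t ^+ 2 }.

Record cstarCat (R : realType) := CstarCat {
  cat_of :> starCat R;
  cat_Cstar : is_Cstar cat_of }.

(** Arrows together with their source and target; equations between arrows
    whose sources and targets are only provably equal are stated here. *)
Record arrow (R : realType) (C : starCat R) := Arrow {
  src : C;
  tgt : C;
  arr : hom C src tgt }.

Arguments Arrow {R C src tgt} arr.

Record starFunctor (R : realType) (C D : starCat R) := StarFunctor {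
  fobj :> C -> D;
  fmap : forall x y : C, hom C x y -> hom D (fobj x) (fobj y);
  fmap1 : forall x : C, fmap (idm x) = idm (fobj x);
  fmap_comp : forall (x y z : C) (t : hom C y z) (s : hom C x y),
    fmap (comp t s) = comp (fmap t) (fmap s);
  fmap_linear : forall x y : C, linear (@fmap x y);
  fmap_star : forall (x y : C) (t : hom C x y), fmap (star t) = star (fmap t) }.

Arguments fmap {R C D} _ {x y} _.

Definition amap (R : realType) (C D : starCat R) (F : starFunctor C D)
    (t : arrow C) : arrow D :=
  Arrow (fmap F (arr t)).

Definition eq_functor (R : realType) (C D : starCat R)
    (F G : starFunctor C D) : Prop :=
  F =1 G /\ amap F =1 amap G.

Definition is_embedding (R : realType) (C D : starCat R)
    (F : starFunctor C D) : Prop :=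
  forall x y : C, injective (fun t : hom C x y => fmap F t).

Definition is_isomorphism (R : realType) (C D : starCat R)
    (F : starFunctor C D) : Prop :=
  bijective (fobj F) /\ bijective (amap F).

Section FunctorOperations.
Variable R : realType.

Definition idF (C : starCat R) : starFunctor C C :=
  @StarFunctor R C C id (fun x y t => t) (fun _ => erefl)
    (fun _ _ _ _ _ => erefl) (fun _ _ _ _ _ => erefl) (fun _ _ _ => erefl).

Variables (C D E : starCat R) (G : starFunctor D E) (F : starFunctor C D).

Lemma compF1 (x : C) : fmap G (fmap F (idm x)) = idm (G (F x)).
Proof. by rewrite !fmap1. Qed.

Lemma compF_comp (x y z : C) (t : hom C y z) (s : hom C x y) :
  fmap G (fmap F (comp t s)) = comp (fmap G (fmap F t)) (fmap G (fmap F s)).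
Proof. by rewrite !fmap_comp. Qed.

Lemma compF_linear (x y : C) :
  linear (fun t : hom C x y => fmap G (fmap F t)).
Proof. by move=> a s t; rewrite !fmap_linear. Qed.

Lemma compF_star (x y : C) (t : hom C x y) :
  fmap G (fmap F (star t)) = star (fmap G (fmap F t)).
Proof. by rewrite !fmap_star. Qed.

Definition compF : starFunctor C E :=
  @StarFunctor R C E (G \o F) (fun x y t => fmap G (fmap F t))
    compF1 compF_comp compF_linear compF_star.

End FunctorOperations.

Section Presheaves.
Variables (R : realType) (d : Order.disp_t) (K : porderType d).

Record presheaf := Presheaf {
  fib :> K -> cstarCat R;
  res : forall o o' : K, (o <= o')%O -> starFunctor (fib o') (fib o);
  res_emb : forall (o o' : K) (h : (o <= o')%O), is_embedding (res h);
  res_comp : forall (o o' o'' : K) (h : (o <= o')%O) (h' : (o' <= o'')%O)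
    (h'' : (o <= o'')%O), eq_functor (compF (res h) (res h')) (res h'') }.

Definition is_bundle (C : presheaf) : Prop :=
  forall (o o' : K) (h : (o <= o')%O), is_isomorphism (res C h).

Record presheaf_mor (C' C : presheaf) := PresheafMor {
  mor :> forall o : K, starFunctor (C' o) (C o);
  mor_res : forall (o o' : K) (h : (o <= o')%O),
    eq_functor (compF (res C h) (mor o')) (compF (mor o) (res C' h)) }.

End Presheaves.

Section ArrowLemmas.
Variables (R : realType) (C : starCat R).

Lemma Arrow_inj (x y : C) : injective (@Arrow R C x y).
Proof.
move=> s t e.
pose cast (u v : arrow C) (es : src u = src v) (et : tgt u = tgt v) :
  hom C (src v) (tgt v) :=
    ecast z (hom C (src v) z) et (ecast z (hom C z (tgt u)) es (arr u)).
have H u v (e' : u = v) : cast u v (f_equal (@src R C) e') (f_equal (@tgt R C) e') = arr v.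
  by case: v / e'.
have := H _ _ e; rewrite /cast /=.
by rewrite (Prop_irrelevance (f_equal (@src R C) e) erefl)
           (Prop_irrelevance (f_equal (@tgt R C) e) erefl).
Qed.

Lemma Arrow_lin (x y x' y' : C) (a : R[i]) (s t : hom C x y)
    (s' t' : hom C x' y') : x = x' -> y = y' ->
  Arrow s = Arrow s' -> Arrow t = Arrow t' ->
  Arrow (a *: s + t) = Arrow (a *: s' + t').
Proof.
move=> ex ey; case: x' / ex s' t' => s' t'; case: y' / ey s' t' => s' t'.
by move=> /Arrow_inj -> /Arrow_inj ->.
Qed.

Lemma Arrow0 (x y x' y' : C) : x = x' -> y = y' ->
  Arrow (0 : hom C x y) = Arrow (0 : hom C x' y').
Proof. by move=> -> ->. Qed.

Lemma Arrow_idm (x x' : C) : x = x' -> Arrow (idm x) = Arrow (idm x').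
Proof. by move=> ->. Qed.

Lemma Arrow_star (x y x' y' : C) (s : hom C x y) (s' : hom C x' y') :
  Arrow s = Arrow s' -> Arrow (star s) = Arrow (star s').
Proof.
pose st (u : arrow C) := Arrow (star (arr u)).
by move=> e; exact: (f_equal st e).
Qed.

Lemma Arrow_comp (x y z x' y' z' : C) (t : hom C y z) (s : hom C x y)
    (t' : hom C y' z') (s' : hom C x' y') : x = x' -> y = y' -> z = z' ->
  Arrow t = Arrow t' -> Arrow s = Arrow s' ->
  Arrow (comp t s) = Arrow (comp t' s').
Proof.
move=> ex ey ez.
case: x' / ex s' => s'; case: z' / ez t' => t'; case: y' / ey t' s' => t' s'.
by move=> /Arrow_inj -> /Arrow_inj ->.
Qed.

End ArrowLemmas.

Section SectionCategory.
Variables (R : realType) (d : Order.disp_t) (K : porderType d).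
Variable C : presheaf R K.

Record sec_obj := SecObj {
  so :> forall o : K, C o;
  so_res : forall (o o' : K) (h : (o <= o')%O), res C h (so o') = so o }.

Record sec_hom (x y : sec_obj) := SecHom {
  sh :> forall o : K, hom (C o) (x o) (y o);
  sh_res : forall (o o' : K) (h : (o <= o')%O),
    Arrow (fmap (res C h) (sh o')) = Arrow (sh o) }.

Section Hom.
Variables x y : sec_obj.

Lemma sec_homP (s t : sec_hom x y) : (forall o, s o = t o) -> s = t.
Proof.
case: s t => [s hs] [t ht] /= e.
have {}e : s = t by apply: functional_extensionality_dep.
by case: t / e ht => ht; rewrite (Prop_irrelevance hs ht).
Qed.

HB.instance Definition _ := gen_eqMixin (sec_hom x y).
HB.instance Definition _ := gen_choiceMixin (sec_hom x y).

Lemma sec_lin_res (a : R[i]) (s t : sec_hom x y) (o o' : K)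
    (h : (o <= o')%O) :
  Arrow (fmap (res C h) (a *: s o' + t o')) = Arrow (a *: s o + t o).
Proof.
by rewrite fmap_linear; apply: Arrow_lin; rewrite ?so_res ?sh_res.
Qed.

Definition sec_lin (a : R[i]) (s t : sec_hom x y) : sec_hom x y :=
  SecHom (sec_lin_res a s t).

Lemma sec0_res (o o' : K) (h : (o <= o')%O) :
  Arrow (fmap (res C h) (0 : hom (C o') (x o') (y o')))
  = Arrow (0 : hom (C o) (x o) (y o)).
Proof.
have -> : fmap (res C h) (0 : hom (C o') (x o') (y o')) = 0.
  have := fmap_linear (res C h) (-1) (0 : hom (C o') (x o') (y o')) 0.
  by rewrite scaler0 add0r scaleN1r addNr.
by apply: Arrow0; rewrite so_res.
Qed.

Definition sec0 : sec_hom x y := SecHom sec0_res.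
Definition sec_add (s t : sec_hom x y) := sec_lin 1 s t.
Definition sec_scale (a : R[i]) (s : sec_hom x y) := sec_lin a s sec0.
Definition sec_opp (s : sec_hom x y) := sec_scale (-1) s.

Lemma sec_addA : associative sec_add.
Proof. by move=> s t u; apply: sec_homP => o /=; rewrite !scale1r addrA. Qed.

Lemma sec_addC : commutative sec_add.
Proof. by move=> s t; apply: sec_homP => o /=; rewrite !scale1r addrC. Qed.

Lemma sec_add0 : left_id sec0 sec_add.
Proof. by move=> s; apply: sec_homP => o /=; rewrite scale1r add0r. Qed.

Lemma sec_addN : left_inverse sec0 sec_opp sec_add.
Proof.
by move=> s; apply: sec_homP => o /=; rewrite scale1r scaleN1r addr0 addNr.
Qed.

HB.instance Definition _ :=
  GRing.isZmodule.Build (sec_hom x y) sec_addA sec_addC sec_add0 sec_addN.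

Lemma sec_addE (s t : sec_hom x y) o : (s + t) o = s o + t o.
Proof. by rewrite /= scale1r. Qed.

Lemma sec_scaleA a b (s : sec_hom x y) :
  sec_scale a (sec_scale b s) = sec_scale (a * b) s.
Proof. by apply: sec_homP => o /=; rewrite !addr0 scalerA. Qed.

Lemma sec_scale1 : left_id 1 sec_scale.
Proof. by move=> s; apply: sec_homP => o /=; rewrite addr0 scale1r. Qed.

Lemma sec_scaleDr : right_distributive sec_scale +%R.
Proof.
by move=> a s t; apply: sec_homP => o /=; rewrite !addr0 !scale1r scalerDr.
Qed.

Lemma sec_scaleDl (s : sec_hom x y) : {morph sec_scale^~ s : a b / a + b}.
Proof.
by move=> a b; apply: sec_homP => o /=; rewrite !addr0 scale1r scalerDl.
Qed.

HB.instance Definition _ := GRing.Zmodule_isLmodule.Build R[i] (sec_hom x y)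
  sec_scaleA sec_scale1 sec_scaleDr sec_scaleDl.

Lemma sec_scaleE a (s : sec_hom x y) o : (a *: s) o = a *: s o.
Proof. by rewrite /= addr0. Qed.

Lemma sec_linE a (s t : sec_hom x y) o : (a *: s + t) o = a *: s o + t o.
Proof. by rewrite sec_addE sec_scaleE. Qed.

(** [sup] is total, with value 0 on an empty or unbounded set. *)
Definition sec_norm (t : sec_hom x y) : R :=
  sup [set hnorm (t o) | o in [set: K]].

End Hom.

Lemma sec_id_res (x : sec_obj) (o o' : K) (h : (o <= o')%O) :
  Arrow (fmap (res C h) (idm (x o'))) = Arrow (idm (x o)).
Proof. by rewrite fmap1; apply: Arrow_idm; rewrite so_res. Qed.

Definition sec_id (x : sec_obj) : sec_hom x x := SecHom (@sec_id_res x).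

Lemma sec_comp_res (x y z : sec_obj) (t : sec_hom y z) (s : sec_hom x y)
    (o o' : K) (h : (o <= o')%O) :
  Arrow (fmap (res C h) (comp (t o') (s o'))) = Arrow (comp (t o) (s o)).
Proof.
by rewrite fmap_comp; apply: Arrow_comp; rewrite ?so_res ?sh_res.
Qed.

Definition sec_comp (x y z : sec_obj) (t : sec_hom y z) (s : sec_hom x y) :
  sec_hom x z := SecHom (sec_comp_res t s).

Lemma sec_star_res (x y : sec_obj) (t : sec_hom x y)
    (o o' : K) (h : (o <= o')%O) :
  Arrow (fmap (res C h) (star (t o'))) = Arrow (star (t o)).
Proof. by rewrite fmap_star; apply: Arrow_star; rewrite sh_res. Qed.

Definition sec_star (x y : sec_obj) (t : sec_hom x y) : sec_hom y x :=
  SecHom (sec_star_res t).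

Lemma sec_comp1m x y (t : sec_hom x y) : sec_comp (sec_id y) t = t.
Proof. by apply: sec_homP => o /=; rewrite comp1m. Qed.

Lemma sec_compm1 x y (t : sec_hom x y) : sec_comp t (sec_id x) = t.
Proof. by apply: sec_homP => o /=; rewrite compm1. Qed.

Lemma sec_compA x y z w (u : sec_hom z w) (t : sec_hom y z)
    (s : sec_hom x y) :
  sec_comp u (sec_comp t s) = sec_comp (sec_comp u t) s.
Proof. by apply: sec_homP => o /=; rewrite compA. Qed.

Lemma sec_comp_linl x y z (s : sec_hom x y) :
  linear (fun t : sec_hom y z => sec_comp t s).
Proof.
move=> a t t'; apply: sec_homP => o.
rewrite sec_linE -[LHS]/(comp ((a *: t + t') o) (s o)) sec_linE.
exact: (comp_linl (s o) a (t o) (t' o)).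
Qed.

Lemma sec_comp_linr x y z (t : sec_hom y z) :
  linear (fun s : sec_hom x y => sec_comp t s).
Proof.
move=> a s s'; apply: sec_homP => o.
rewrite sec_linE -[LHS]/(comp (t o) ((a *: s + s') o)) sec_linE.
exact: (comp_linr (t o) a (s o) (s' o)).
Qed.

Lemma sec_star_antilinear x y (a : R[i]) (s t : sec_hom x y) :
  sec_star (a *: s + t) = a^* *: sec_star s + sec_star t.
Proof.
apply: sec_homP => o.
rewrite sec_linE -[LHS]/(star ((a *: s + t) o)) sec_linE.
exact: star_antilinear.
Qed.

Lemma sec_starK x y (t : sec_hom x y) : sec_star (sec_star t) = t.
Proof. by apply: sec_homP => o /=; rewrite starK. Qed.

Lemma sec_star_comp x y z (t : sec_hom y z) (s : sec_hom x y) :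
  sec_star (sec_comp t s) = sec_comp (sec_star s) (sec_star t).
Proof. by apply: sec_homP => o /=; rewrite star_comp. Qed.

Definition section_cat : starCat R :=
  @StarCat R sec_obj (fun x y => sec_hom x y : lmodType R[i])
    sec_norm sec_id sec_comp sec_star sec_comp1m sec_compm1 sec_compA
    sec_comp_linl sec_comp_linr sec_star_antilinear sec_starK sec_star_comp.

End SectionCategory.

Section SectionFunctor.
Variables (R : realType) (d : Order.disp_t) (K : porderType d).
Variables (C' C : presheaf R K) (P : presheaf_mor C' C).

Lemma sec_fobj_res (x : sec_obj C') (o o' : K) (h : (o <= o')%O) :
  res C h (P o' (x o')) = P o (x o).
Proof. by have [/(_ (x o')) /= -> _] := mor_res P h; rewrite so_res. Qed.

Definition sec_fobj (x : sec_obj C') : sec_obj C := SecObj (sec_fobj_res x).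

Lemma sec_fmap_res (x y : sec_obj C') (t : sec_hom x y)
    (o o' : K) (h : (o <= o')%O) :
  Arrow (fmap (res C h) (fmap (P o') (t o'))) = Arrow (fmap (P o) (t o)).
Proof.
have [_ /(_ (Arrow (t o')))] := mor_res P h.
rewrite {1 2}/amap /= => ->.
exact: (f_equal (amap (P o)) (sh_res t h)).
Qed.

Definition sec_fmap (x y : sec_obj C') (t : sec_hom x y) :
  sec_hom (sec_fobj x) (sec_fobj y) :=
  @SecHom _ _ _ _ (sec_fobj x) (sec_fobj y) (fun o => fmap (P o) (t o))
    (sec_fmap_res t).

Lemma sec_fmap1 (x : sec_obj C') : sec_fmap (sec_id x) = sec_id (sec_fobj x).
Proof. by apply: sec_homP => o /=; rewrite fmap1. Qed.

Lemma sec_fmap_comp (x y z : sec_obj C') (t : sec_hom y z) (s : sec_hom x y) :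
  sec_fmap (sec_comp t s) = sec_comp (sec_fmap t) (sec_fmap s).
Proof. by apply: sec_homP => o /=; rewrite fmap_comp. Qed.

Lemma sec_fmap_linear (x y : sec_obj C') : linear (@sec_fmap x y).
Proof.
move=> a s t; apply: sec_homP => o.
rewrite sec_linE -[LHS]/(fmap (P o) ((a *: s + t) o)) sec_linE.
exact: fmap_linear.
Qed.

Lemma sec_fmap_star (x y : sec_obj C') (t : sec_hom x y) :
  sec_fmap (sec_star t) = sec_star (sec_fmap t).
Proof. by apply: sec_homP => o /=; rewrite fmap_star. Qed.

Definition section_functor : starFunctor (section_cat C') (section_cat C) :=
  @StarFunctor R (section_cat C') (section_cat C) sec_fobj sec_fmap
    sec_fmap1 sec_fmap_comp sec_fmap_linear sec_fmap_star.

End SectionFunctor.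

(** An isomorphism from a presheaf over [K] to a presheaf over [L], lying over
    an isomorphism of posets [f : K -> L]. *)
Record presheaf_iso (R : realType) (d d' : Order.disp_t)
    (K : porderType d) (L : porderType d') (f : K -> L)
    (C : presheaf R K) (D : presheaf R L) := PresheafIso {
  piso :> forall o : K, starFunctor (C o) (D (f o));
  piso_res : forall (o o' : K) (h : (o <= o')%O) (h' : (f o <= f o')%O),
    eq_functor (compF (res D h') (piso o')) (compF (piso o) (res C h));
  piso_bij : forall o : K, is_isomorphism (piso o) }.

(** A construction assigning to each presheaf C over a pathwise connected poset
    a presheaf [beta hK C] with a morphism to C.  That it involves no choice is
    rendered by naturality: isomorphisms of the data (poset and presheaf) act
    functorially on [beta], and [betaP] intertwines the two actions. *)
Record canonical_construction (R : realType) := CanonicalConstruction {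
  beta : forall (d : Order.disp_t) (K : porderType d),
    pathwise_connected K -> presheaf R K -> presheaf R K;
  betaP : forall (d : Order.disp_t) (K : porderType d)
    (hK : pathwise_connected K) (C : presheaf R K),
    presheaf_mor (beta hK C) C;
  beta_map : forall (d d' : Order.disp_t)
    (K : porderType d) (L : porderType d')
    (hK : pathwise_connected K) (hL : pathwise_connected L)
    (f : K -> L) (hf : order_isomorphism f)
    (C : presheaf R K) (D : presheaf R L),
    presheaf_iso f C D -> presheaf_iso f (beta hK C) (beta hL D);
  betaP_natural : forall (d d' : Order.disp_t)
    (K : porderType d) (L : porderType d')
    (hK : pathwise_connected K) (hL : pathwise_connected L)
    (f : K -> L) (hf : order_isomorphism f)
    (C : presheaf R K) (D : presheaf R L) (F : presheaf_iso f C D) (o : K),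
    eq_functor (compF (betaP hL D (f o)) (beta_map hK hL hf F o))
               (compF (F o) (betaP hK C o));
  beta_map_id : forall (d : Order.disp_t) (K : porderType d)
    (hK : pathwise_connected K) (hid : order_isomorphism (@id K))
    (C : presheaf R K) (F : presheaf_iso id C C),
    (forall o : K, eq_functor (F o) (idF (C o))) ->
    forall o : K,
      eq_functor (beta_map hK hK hid F o) (idF (beta hK C o));
  beta_map_comp : forall (d1 d2 d3 : Order.disp_t)
    (K : porderType d1) (L : porderType d2) (M : porderType d3)
    (hK : pathwise_connected K) (hL : pathwise_connected L)
    (hM : pathwise_connected M) (f : K -> L) (g : L -> M)
    (hf : order_isomorphism f) (hg : order_isomorphism g)
    (hgf : order_isomorphism (g \o f))
    (C : presheaf R K) (D : presheaf R L) (E : presheaf R M)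
    (F : presheaf_iso f C D) (G : presheaf_iso g D E)
    (H : presheaf_iso (g \o f) C E),
    (forall o : K, eq_functor (H o) (compF (G (f o)) (F o))) ->
    forall o : K,
      eq_functor (beta_map hK hM hgf H o)
        (compF (beta_map hL hM hg G (f o)) (beta_map hK hL hf F o)) }.

(* Main.v *)
Require Import Defs.
From HB Require Import structures.
From mathcomp Require Import all_boot all_order all_algebra.
From mathcomp Require Import reals.
From mathcomp Require Import complex boolp classical_sets.
From mathcomp Require Import topology normedtype sequences lra ring.

(** The bundle is the constant presheaf whose fibre is the section category of
    C, and P evaluates sections.  As K is pathwise connected, a section of a
    constant presheaf is a constant family, so P induces an isomorphism between
    the section categories.

    The analytic point is that the section category is a C*-category: the
    supremum defining its norm is finite because an injective *-functor F is
    isometric.  By the C*-identity only self-adjoint endomorphisms matter.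
    - If k is self-adjoint of norm 1, then 1 - k^2 has no left inverse.  Indeed
      a solution G of G (1 - k^2) = k^2 has norm at least 1/2, and
      k^2 (1 + k^2)^-1 G, of norm at most |G| / 2 by means of the Cayley
      transform of k, is a solution for k^2 in place of k; iterating, |G| is
      arbitrarily large.
    - Hence F is contractive: if |h| < 1 = |F h|, then 1 - h^2 is invertible by
      the Neumann series, and so is 1 - (F h)^2.
    - If |h| = 1 and r = |F (h^2)| < 1, put p = h^2 and x = (p - s) / 2 with
      r < s < 1, and let y be the square root of x^2 obtained by iterating
      w |-> (1 - x^2 + w^2) / 2 for w = 1 - y.  Then (y - x) (y + x) = 0 and
      F (y - x) is invertible, so F (y + x) = 0 and y = - x by injectivity;
      this makes 1 - p invertible, a contradiction. *)

Set Implicit Arguments.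
Unset Strict Implicit.
Unset Printing Implicit Defensive.

(* [vector] also defines a constant [hom]. *)
Import Defs.
Import Order.TTheory GRing.Theory Num.Theory.
Import numFieldNormedType.Exports.
Import ComplexField.Normc.
Local Open Scope ring_scope.
Local Open Scope classical_set_scope.
Local Open Scope complex_scope.

(** * Banach norms *)

Lemma normcR (R : realType) (r : R) : normc r%:C = `|r|.
Proof. by rewrite /normc /= expr0n addr0 sqrtr_sqr. Qed.

Lemma complex_normE (R : realType) (c : R[i]) : `|c| = (normc c)%:C.
Proof. by case: c. Qed.

(* A Cauchy condition in the form in which it arises for iterations dominated
   by a real one. *)
Definition bounded_variation (R : realType) (V : zmodType) (N : V -> R)
    (u : nat -> V) : Prop :=
  exists (v : nat -> R) (M : R),
    (forall n, N (u n.+1 - u n) <= v n.+1 - v n) /\ (forall n, v n <= M).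

Definition seq_limit (R : realType) (V : zmodType) (N : V -> R)
    (u : nat -> V) (l : V) : Prop :=
  forall e : R, 0 < e -> exists n0, forall n, (n0 <= n)%N -> N (u n - l) <= e.

(** Equivalent to [banach_norm] by [banach_norm_axioms] and [axioms_banach_norm], but phrased with
    sequences, so that completeness is used and checked without filters. *)
Record norm_axioms (R : realType) (V : lmodType R[i]) (N : V -> R) : Prop :=
  NormAxioms {
    norm_triangle : forall u v, N (u + v) <= N u + N v;
    norm_scale : forall c v, N (c *: v) = normc c * N v;
    norm_eq0 : forall v, N v = 0 -> v = 0;
    norm_complete : forall u, bounded_variation N u ->
      exists l, seq_limit N u l }.

Section NormTheory.
Variables (R : realType) (V : lmodType R[i]) (N : V -> R).
Hypothesis HN : norm_axioms N.

Lemma norm_0 : N 0 = 0.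
Proof. by rewrite -(scale0r (0 : V)) norm_scale // normc0 mul0r. Qed.

Lemma norm_N v : N (- v) = N v.
Proof. by rewrite -scaleN1r norm_scale // normcN normc1 mul1r. Qed.

Lemma norm_ge0 v : 0 <= N v.
Proof.
have := norm_triangle HN v (- v); rewrite subrr norm_0 norm_N -mulr2n.
by rewrite pmulrn_lge0.
Qed.

Lemma norm_sub u v : N (u - v) <= N u + N v.
Proof. by rewrite -(norm_N v); exact: norm_triangle. Qed.

Lemma norm_dist u v : N (u - v) = N (v - u).
Proof. by rewrite -norm_N opprB. Qed.

Lemma norm_split w u v : N (u - v) <= N (u - w) + N (w - v).
Proof.
by have := norm_triangle HN (u - w) (w - v); rewrite addrA subrK.
Qed.

Lemma norm_scaler (r : R) v : 0 <= r -> N (r%:C *: v) = r * N v.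
Proof. by move=> r0; rewrite norm_scale // normcR ger0_norm. Qed.

Lemma norm_small v : (forall e : R, 0 < e -> N v <= e) -> v = 0.
Proof.
move=> h; apply: (norm_eq0 HN); apply/eqP; rewrite eq_le norm_ge0 andbT.
by apply/ler_addgt0Pl => e e0; rewrite addr0 h.
Qed.

Lemma seq_limit_unique u l l' : seq_limit N u l -> seq_limit N u l' -> l = l'.
Proof.
move=> ul ul'; apply/eqP; rewrite -subr_eq0; apply/eqP.
apply: norm_small => e e0; have e2 : 0 < e / 2 by lra.
have [n0 h0] := ul _ e2; have [n1 h1] := ul' _ e2.
have := norm_split (u (n0 + n1)%N) l l'; rewrite (norm_dist l (u _)).
have := h0 _ (leq_addr n1 n0); have := h1 _ (leq_addl n0 n1); lra.
Qed.

Lemma seq_limit_bound u l M : seq_limit N u l -> (forall n, N (u n) <= M) ->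
  N l <= M.
Proof.
move=> ul uM; apply/ler_addgt0Pl => e /ul[n0 /(_ _ (leqnn n0))] h.
have := norm_split 0 l (l - u n0); rewrite opprB addrCA subrr !subr0 addr0.
have := norm_triangle HN (l - u n0) (u n0); rewrite subrK norm_dist.
have := uM n0; lra.
Qed.

End NormTheory.

Section BanachNorm.
Variables (R : realType) (V : lmodType R[i]) (N : V -> R).

(** Take [n0] with [v n0] within [e] of the supremum of [v]; the increments of [u] telescope below
    those of [v]. *)
Lemma bounded_variation_cauchy (v : nat -> R) (u : nat -> V) (M : R) :
    (forall a b, N (a + b) <= N a + N b) -> N 0 = 0 ->
    (forall n, N (u n.+1 - u n) <= v n.+1 - v n) -> (forall n, v n <= M) ->
    (forall a, 0 <= N a) ->
  forall e, 0 < e -> exists n0, forall n, (n0 <= n)%N -> N (u n - u n0) <= e.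
Proof.
move=> triN N0 uv vM Nge0 e e0.
have S0 : has_sup (range v).
  by split; [exists (v 0%N); exists 0%N | exists M => _ [n _ <-]].
have [_ [n0 _ <-] hn0] := sup_adherent e0 S0.
exists n0 => n le_n; have : N (u n - u n0) <= v n - v n0.
  rewrite -(subnK le_n); elim: (n - n0)%N => [|m IH].
    by rewrite !subrr N0.
  rewrite addSn -(subrK (u (m + n0)%N) (u (m + n0).+1)) -addrA.
  by have := triN (u (m + n0).+1 - u (m + n0)%N) (u (m + n0)%N - u n0);
     have := uv (m + n0)%N; move: IH; lra.
have : v n <= sup (range v) by apply: sup_upper_bound => //; exists n.
move: hn0; lra.
Qed.

Lemma banach_norm_axioms : banach_norm N -> norm_axioms N.
Proof.
move=> [B [f [flin fbij fN]]].
have fD u v : f (u + v) = f u + f v by rewrite -{1}(scale1r u) flin scale1r.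
have f0 : f 0 = 0 by apply: (addrI (f 0)); rewrite -fD !addr0.
have fZ c u : f (c *: u) = c *: f u by rewrite -(addr0 (c *: u)) flin f0 addr0.
have fB u v : f (u - v) = f u - f v by rewrite fD -scaleN1r fZ scaleN1r.
have triN u v : N (u + v) <= N u + N v.
  by rewrite -lecR rmorphD /= -!fN fD ler_normD.
have zN c v : N (c *: v) = normc c * N v.
  by apply: (@complexI R); rewrite rmorphM /= -!fN -complex_normE fZ normrZ.
have N0 v : N v = 0 -> v = 0.
  move=> Nv; apply: (bij_inj fbij); apply/eqP; rewrite f0 -normr_eq0 fN Nv.
  by [].
have Nge0 v : 0 <= N v by rewrite -lecR -fN normr_ge0.
split => // u [v [M [uv vM]]].
have [g fK gK] := fbij.
have N00 : N 0 = 0 by apply: (@complexI R); rewrite -fN f0 normr0.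
have cu := bounded_variation_cauchy triN N00 uv vM Nge0.
have normN x y : N (x - y) = N (y - x).
  by apply: (@complexI R); rewrite -!fN !fB distrC.
have : cauchy (f \o u @ \oo).
  apply/cauchy_exP => eps eps0.
  have [e epsE e0] : exists2 e : R, eps = e%:C & 0 < e.
    by case: eps eps0 => a b; rewrite ltcE /= => /andP[/eqP -> a0]; exists a.
  have e2 : 0 < e / 2 by lra.
  have [n0 hn0] := cu _ e2; exists (f (u n0)).
  exists n0 => // n /= le_n; rewrite -ball_normE /= -fB fN epsE ltcR normN.
  by apply: le_lt_trans (hn0 _ le_n) _; lra.
move=> /cauchy_cvg/cvg_ex[/= l /cvgrPdist_le ul].
exists (g l) => e e0.
have ec : 0 < e%:C by rewrite ltcR.
have [n0 _ hn0] := ul _ ec.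
by exists n0 => n /hn0; rewrite -{1}(gK l) -fB fN lecR normN.
Qed.

End BanachNorm.

(** * Banach spaces from the sequential axioms *)

Section BanachOfAxioms.
Variables (R : realType) (V : lmodType R[i]) (N : V -> R).
Hypothesis HN : norm_axioms N.

(** Indexed by the proof of the axioms, so that the instances of normed and complete space on this
    copy of [V] can depend on [N]. *)
Definition normed_copy of norm_axioms N : Type := V.
Local Notation W := (normed_copy HN).
HB.instance Definition _ := GRing.Lmodule.on W.

Let nrm (w : W) : R[i] := (N w)%:C.

Lemma nrm_triangle (x y : W) : nrm (x + y) <= nrm x + nrm y.
Proof. by rewrite /nrm -rmorphD lecR; exact: (norm_triangle HN). Qed.

Lemma nrm_scale (c : R[i]) (x : W) : nrm (c *: x) = `|c| * nrm x.
Proof. by rewrite /nrm complex_normE -rmorphM (norm_scale HN). Qed.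

Lemma nrm_eq0 (x : W) : nrm x = 0 -> x = 0.
Proof. by move=> /(@complexI R); exact: (norm_eq0 HN). Qed.

HB.instance Definition _ :=
  Lmodule_isNormed.Build R[i] W nrm_triangle nrm_scale nrm_eq0.

Lemma normed_copyE (w : W) : `|w| = (N w)%:C.
Proof. by []. Qed.

(** Any two balls of the filter meet, so centres [u n] of balls of radius [2^-n] have bounded
    variation; their limit is the limit of the filter. *)
Lemma normed_copy_complete (F : set_system W) :
  ProperFilter F -> cauchy F -> cvg F.
Proof.
move=> FF /cauchyP cF.
have pos n : 0 < (2^-1 ^+ n : R)%:C by rewrite ltcR exprn_gt0// invr_gt0.
have /choice[u Fu] : forall n, exists x : W, F (ball x (2^-1 ^+ n : R)%:C).
  by move=> n; exact: cF.
have near_u (m n : nat) : N (u m - u n) <= 2^-1 ^+ m + 2^-1 ^+ n.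
  have [w [um un]] := filter_ex (filterI (Fu m) (Fu n)).
  apply: le_trans (norm_split HN w _ _) _.
  move: um un; rewrite -!ball_normE /= !normed_copyE !ltcR => /ltW um /ltW un.
  by rewrite (norm_dist HN w) lerD.
have [l ul] : exists l, seq_limit N u l.
  apply: (norm_complete HN).
  (* This sequence has increments [2 * 2^-n], enough for the distance [2^-n + 2^-(n+1)] of
     consecutive centres. *)
  exists (fun n => - (4 * 2^-1 ^+ n)), 0; split=> n; last first.
    by rewrite oppr_le0 mulr_ge0 // exprn_ge0 ?invr_ge0.
  have : 0 <= 2^-1 ^+ n :> R by rewrite exprn_ge0 ?invr_ge0.
  by move=> ?; apply: le_trans (near_u _ _) _; rewrite exprS; lra.
apply/cvg_ex; exists (l : W); apply/cvgrPdist_le => eps eps0.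
have [e epsE e0] : exists2 e : R, eps = e%:C & 0 < e.
  by case: eps eps0 => a b; rewrite ltcE /= => /andP[/eqP -> a0]; exists a.
have e2 : 0 < e / 2 by lra.
have [n0 hn0] := ul _ e2.
have [n1 hn1] : exists n1, forall n, (n1 <= n)%N -> 2^-1 ^+ n <= e / 2.
  have := @cvg_expr R 2^-1.
  have -> : `|2^-1| < 1 :> R by rewrite ger0_norm; lra.
  move=> /(_ isT)/cvgrPdist_le/(_ _ e2)[n1 _ hn1]; exists n1 => n /hn1.
  by rewrite sub0r normrN ger0_norm // exprn_ge0 ?invr_ge0.
apply: filterS (Fu (n0 + n1)%N) => w; rewrite -ball_normE /= !normed_copyE.
rewrite epsE ltcR lecR => /ltW uw.
apply: le_trans (norm_split HN (u (n0 + n1)%N) _ _) _.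
rewrite (norm_dist HN l).
by have := hn0 _ (leq_addr n1 n0); have := hn1 _ (leq_addl n0 n1); lra.
Qed.

HB.instance Definition _ := Uniform_isComplete.Build W normed_copy_complete.

Lemma axioms_banach_norm : banach_norm N.
Proof.
exists (W : completeNormedModType R[i]), (id : V -> W).
by split => //; exists id.
Qed.

End BanachOfAxioms.

(** * C*-categories *)

Ltac complex_ring :=
  apply/eqP; rewrite eq_complex /=; apply/andP; split; apply/eqP; ring.

(** The shifted sequence [T (u n)] tends to [l], and also to [T l], since [T] does not increase the
    distance from [u n] to [l]. *)
Lemma fixpoint_of_limit (R : realType) (V : lmodType R[i]) (N : V -> R)
    (T : V -> V) (u : nat -> V) (l : V) :
  norm_axioms N -> (forall n, u n.+1 = T (u n)) -> seq_limit N u l ->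
  (forall n, N (T (u n) - T l) <= N (u n - l)) -> T l = l.
Proof.
move=> HN uT ul Tl; apply: (seq_limit_unique HN (u := u \o succn)).
  move=> e /ul[n0 h]; exists n0 => n /h; apply: le_trans.
  by rewrite /= uT; exact: Tl.
by move=> e /ul[n0 h]; exists n0 => n le_n; apply: h; rewrite leqW.
Qed.

(** * Bilinearity of composition and the involution *)

Section StarCategoryAlgebra.
Variables (R : realType) (C : starCat R).
Local Notation "t \c s" := (comp t s) (at level 40, left associativity).

Lemma compDl x y z (t t' : hom C y z) (s : hom C x y) :
  (t + t') \c s = t \c s + t' \c s.
Proof. by have := comp_linl s 1 t t'; rewrite !scale1r. Qed.

Lemma compDr x y z (t : hom C y z) (s s' : hom C x y) :
  t \c (s + s') = t \c s + t \c s'.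
Proof. by have := comp_linr t 1 s s'; rewrite !scale1r. Qed.

Lemma comp0l x y z (s : hom C x y) : (0 : hom C y z) \c s = 0.
Proof. by apply: (addrI (0 \c s)); rewrite -compDl !addr0. Qed.

Lemma comp0r x y z (t : hom C y z) : t \c (0 : hom C x y) = 0.
Proof. by apply: (addrI (t \c 0)); rewrite -compDr !addr0. Qed.

Lemma compZl x y z a (t : hom C y z) (s : hom C x y) :
  (a *: t) \c s = a *: (t \c s).
Proof. by have := comp_linl s a t 0; rewrite comp0l !addr0. Qed.

Lemma compZr x y z a (t : hom C y z) (s : hom C x y) :
  t \c (a *: s) = a *: (t \c s).
Proof. by have := comp_linr t a s 0; rewrite comp0r !addr0. Qed.

Lemma compNl x y z (t : hom C y z) (s : hom C x y) : (- t) \c s = - (t \c s).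
Proof. by rewrite -scaleN1r compZl scaleN1r. Qed.

Lemma compNr x y z (t : hom C y z) (s : hom C x y) : t \c (- s) = - (t \c s).
Proof. by rewrite -scaleN1r compZr scaleN1r. Qed.

Lemma compBl x y z (t t' : hom C y z) (s : hom C x y) :
  (t - t') \c s = t \c s - t' \c s.
Proof. by rewrite compDl compNl. Qed.

Lemma compBr x y z (t : hom C y z) (s s' : hom C x y) :
  t \c (s - s') = t \c s - t \c s'.
Proof. by rewrite compDr compNr. Qed.

Lemma starD x y (s t : hom C x y) : star (s + t) = star s + star t.
Proof. by have := star_antilinear 1 s t; rewrite rmorph1 !scale1r. Qed.

Lemma star0 x y : star (0 : hom C x y) = 0.
Proof. by apply: (addrI (star 0)); rewrite -starD !addr0. Qed.

Lemma starZ x y a (t : hom C x y) : star (a *: t) = conjc a *: star t.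
Proof. by have := star_antilinear a t 0; rewrite star0 !addr0. Qed.

Lemma starZr x y (r : R) (t : hom C x y) : star (r%:C *: t) = r%:C *: star t.
Proof. by rewrite starZ /= oppr0. Qed.

Lemma starN x y (t : hom C x y) : star (- t) = - star t.
Proof. by apply/eqP; rewrite -addr_eq0 -starD addNr star0. Qed.

Lemma star1 x : star (idm x) = idm x :> hom C x x.
Proof.
by have := star_comp (idm x) (star (idm x)); rewrite comp1m !starK comp1m.
Qed.

Lemma comp_affine x (k : hom C x x) (a b c d : R[i]) :
  (a *: k + b *: idm x) \c (c *: k + d *: idm x) =
  (a * c) *: (k \c k) + (a * d + b * c) *: k + (b * d) *: idm x.
Proof.
rewrite compDl !compDr !compZl !compZr !scalerA !(comp1m, compm1) scalerDl.
by rewrite !addrA.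
Qed.

End StarCategoryAlgebra.

(** * Invertibility and norms of self-adjoint endomorphisms *)

Section CstarAlgebra.
Variables (R : realType) (C : cstarCat R).
Local Notation "t \c s" := (comp t s) (at level 40, left associativity).

Lemma hnorm_axioms (x y : C) : norm_axioms (fun t : hom C x y => hnorm t).
Proof. exact/banach_norm_axioms/(hom_banach (cat_Cstar C)). Qed.

Lemma hnormM (x y z : C) (t : hom C y z) (s : hom C x y) :
  hnorm (t \c s) <= hnorm t * hnorm s.
Proof. exact/hnorm_comp/cat_Cstar. Qed.

Lemma hnormC (x y : C) (t : hom C x y) : hnorm (star t \c t) = hnorm t ^+ 2.
Proof. exact/hnorm_star/cat_Cstar. Qed.

Lemma hnorm_ge0 (x y : C) (t : hom C x y) : 0 <= hnorm t.
Proof. exact: (norm_ge0 (hnorm_axioms x y)). Qed.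

(** Not an equality: the identity of a zero object has norm 0. *)
Lemma hnorm1 (x : C) : hnorm (idm x) <= 1.
Proof.
have := hnormC (idm x); rewrite star1 comp1m; have := hnorm_ge0 (idm x); nra.
Qed.

Lemma hnorm_star_eq (x y : C) (t : hom C x y) : hnorm (star t) = hnorm t.
Proof.
have le (a b : C) (s : hom C a b) : hnorm s <= hnorm (star s).
  have := hnormM (star s) s; rewrite hnormC.
  by have := hnorm_ge0 s; have := hnorm_ge0 (star s); nra.
by apply/eqP; rewrite eq_le le -{2}(starK t) le.
Qed.

Variable x : C.
Local Notation A := (hom C x x).
Local Notation one := (idm x : hom C x x).
Local Notation N := (fun t : hom C x x => hnorm t).
Let HN : norm_axioms N := hnorm_axioms x x.

(** The iterates of [b |-> 1 + b a] from 0 are the partial sums of the Neumann series, dominated by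
    the geometric series of [q]; a fixed point is a left inverse of [1 - a]. *)
Lemma neumann1 (a : A) : hnorm a < 1 -> exists b : A, b \c (one - a) = one.
Proof.
move=> a1; pose T (b : A) := one + b \c a; pose u n := iter n T (0 : A).
have TB b c : T b - T c = (b - c) \c a.
  by rewrite /T opprD addrACA subrr add0r compBl.
have a0 := hnorm_ge0 a; set q := hnorm a in a0 a1.
have du n : hnorm (u n.+1 - u n) <= q ^+ n.
  elim: n => [|n IH]; first by rewrite /u/= /T comp0l addr0 subr0 hnorm1.
  rewrite {1}/u /= -/(u n.+1) -/(u n) TB; apply: le_trans (hnormM _ _) _.
  by rewrite exprSr ler_wpM2r.
have q1 : 0 < 1 - q by rewrite subr_gt0.
have [|l ul] := norm_complete HN (u := u).
  exists (fun n => (1 - q ^+ n) / (1 - q)), (1 - q)^-1; split=> n.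
    apply: le_trans (du n) _; rewrite -mulrBl exprS.
    have -> : 1 - q * q ^+ n - (1 - q ^+ n) = (1 - q) * q ^+ n by ring.
    by rewrite (mulrC (1 - q)) mulfK // gt_eqF.
  rewrite -[leRHS]mul1r ler_wpM2r ?invr_ge0 ?(ltW q1) //.
  by have := exprn_ge0 n a0; lra.
exists l; rewrite compBr compm1 -[X in X - _](_ : T l = l) ?addrK //.
apply: (fixpoint_of_limit HN (u := u)) => // n.
rewrite TB; apply: le_trans (hnormM _ _) _.
by have := hnorm_ge0 (u n - l); rewrite -/q; nra.
Qed.

Lemma neumann (c : R[i]) (a : A) :
  hnorm a < normc c -> exists b : A, b \c (c *: one - a) = one.
Proof.
move=> ac; have c0 : 0 < normc c by apply: le_lt_trans ac; exact: hnorm_ge0.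
have cn0 : c != 0 by apply: contraTneq c0 => ->; rewrite normc0 ltxx.
have [|b hb] := @neumann1 (c^-1 *: a).
  by rewrite (norm_scale HN) normcV mulrC ltr_pdivrMr // mul1r.
exists (c^-1 *: b); rewrite compZl -compZr scalerBr scalerA mulVf //.
by rewrite scale1r.
Qed.

(** The trick of Arens: [k - i = (k + i s) - i (s + 1)], and for [s = |k|^2] the C*-identity gives
    [|k + i s|^2 <= s + s^2 < (s + 1)^2], so the Neumann series applies. *)
Lemma arens (k : A) : star k = k -> exists b : A, b \c (k - 'i *: one) = one.
Proof.
move=> sk; pose s := hnorm k ^+ 2; have s0 : 0 <= s by exact: sqr_ge0.
have ks : hnorm (k + (s *i) *: one) ^+ 2 <= s + s ^+ 2.
  rewrite -hnormC starD sk starZ star1.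
  have := comp_affine k 1 (s *i)^* 1 (s *i); rewrite !scale1r => ->.
  have -> : 1 * (s *i) + (s *i)^* * 1 = 0 :> R[i] by complex_ring.
  have -> : (s *i)^* * (s *i) = (s ^+ 2)%:C :> R[i] by complex_ring.
  rewrite scale0r addr0 mul1r scale1r.
  apply: le_trans (norm_triangle HN _ _) _; apply: lerD.
    by have := hnormC k; rewrite sk => ->.
  rewrite norm_scaler ?sqr_ge0 //.
  by have := hnorm1 x; have := sqr_ge0 s; nra.
have [|b hb] := @neumann ((s + 1) *i) (k + (s *i) *: one).
  rewrite /normc expr0n add0r sqrtr_sqr ger0_norm; last lra.
  by have := hnorm_ge0 (k + (s *i) *: one); nra.
exists (- b); rewrite compNl -compNr -[RHS]hb; congr (_ \c _).
have -> : (s + 1) *i = 'i + s *i by complex_ring.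
by rewrite scalerDl opprB opprD addrACA subrr addr0.
Qed.

Lemma arensN (k : A) : star k = k -> exists b : A, b \c (k + 'i *: one) = one.
Proof.
move=> sk; have [|b hb] := @arens (- k); first by rewrite starN sk.
by exists (- b); rewrite compNl -compNr opprD.
Qed.

(** With [k' = k / sqrt s], one has [k^2 + s = s (k' + i) (k' - i)]. *)
Lemma arens_square (k : A) (s : R) : star k = k -> 0 < s ->
  exists b : A, b \c (k \c k + s%:C *: one) = one.
Proof.
move=> sk s0; pose r := Num.sqrt s.
have r0 : 0 < r by rewrite sqrtr_gt0.
have rs : s = r ^+ 2 by rewrite sqr_sqrtr // ltW.
pose k' := (r^-1)%:C *: k.
have sk' : star k' = k' by rewrite starZr sk.
have [b hb] := arens sk'; have [b' hb'] := arensN sk'.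
exists ((s^-1)%:C *: (b \c b')).
have -> : k \c k + s%:C *: one = s%:C *: ((k' + 'i *: one) \c (k' - 'i *: one)).
  have := comp_affine k' 1 'i 1 (- 'i); rewrite !scale1r scaleNr => ->.
  have -> : 1 * - 'i + 'i * 1 = 0 :> R[i] by complex_ring.
  have -> : 'i * - 'i = 1 :> R[i] by complex_ring.
  rewrite scale0r addr0 mulr1 !scale1r scalerDr /k' compZl compZr !scalerA.
  rewrite -[X in X + _]scale1r; congr (_ *: _ + _); rewrite -!rmorphM rs /=.
  by rewrite -[1]/(1%:C); congr (_%:C); field; rewrite gt_eqF.
rewrite compZl compZr scalerA -rmorphM mulVf ?gt_eqF // scale1r.
by rewrite -compA (compA b') hb' comp1m hb.
Qed.

(** The Cayley transform [U = (k - i) (k + i)^-1] has norm at most 1, and [M = k (1 + k^2)^-1]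
    equals [(U^* - U) / 4i], so [|M| <= 1/2]. The witness is [k M]. *)
Lemma cayley_bound (k : A) : star k = k ->
  exists2 w : A, w \c (one + k \c k) = k \c k & hnorm w <= hnorm k / 2.
Proof.
move=> sk; pose u := k + 'i *: one; pose v := k - 'i *: one.
have [b bv] : exists b : A, b \c v = one by exact: arens.
have [b' bu] : exists b : A, b \c u = one by exact: arensN.
have sv : star v = u.
  rewrite /v starD sk starN starZ star1 /u -scaleNr; congr (_ + _ *: _).
  by complex_ring.
(* The adjoint of a left inverse of [v] is a right inverse of [u]; together with the left inverse
   [b'] it is two-sided. *)
pose a := star b; have ua : u \c a = one by rewrite -sv -star_comp bv star1.
have au : a \c u = one.
  by rewrite -[a]comp1m -bu -(compA b') ua compm1.
have uv : u \c v = k \c k + one.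
  have := comp_affine k 1 'i 1 (- 'i); rewrite !scale1r scaleNr => ->.
  have -> : 1 * - 'i + 'i * 1 = 0 :> R[i] by complex_ring.
  have -> : 'i * - 'i = 1 :> R[i] by complex_ring.
  by rewrite scale0r addr0 mulr1 !scale1r.
have vu : v \c u = u \c v.
  have := comp_affine k 1 (- 'i) 1 'i; rewrite !scale1r scaleNr uv => ->.
  have -> : 1 * 'i + - 'i * 1 = 0 :> R[i] by complex_ring.
  have -> : - 'i * 'i = 1 :> R[i] by complex_ring.
  by rewrite scale0r addr0 mulr1 !scale1r.
pose U := v \c a; have sU : star U = b \c u by rewrite star_comp starK sv.
have U1 : hnorm U <= 1.
  have := hnormC U; rewrite sU /U compA -(compA b) -vu compA bv comp1m ua.
  by have := hnorm1 x; have := hnorm_ge0 (v \c a); nra.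
pose M := b \c k \c a.
have UM : (4 *i) *: M = star U - U.
  rewrite sU /U; have -> : b \c u = b \c (u \c u) \c a.
    by rewrite -!compA ua compm1.
  have -> : v \c a = b \c (v \c v) \c a by rewrite (compA b) bv comp1m.
  rewrite -compBl -compBr.
  have := comp_affine k 1 'i 1 'i; rewrite !scale1r -/u => ->.
  have := comp_affine k 1 (- 'i) 1 (- 'i); rewrite !scale1r !scaleNr -/v => ->.
  rewrite !mulr1 !mul1r mulrNN.
  have E (p q r s : A) : p + q + s - (p + r + s) = q - r.
    by rewrite opprD addrACA subrr addr0 opprD addrACA subrr add0r.
  rewrite E -scaleNr -scalerDl /M compZr compZl.
  by congr (_ *: _); complex_ring.
have M1 : hnorm M <= 2^-1.
  have := norm_scale HN (4 *i) M; rewrite UM /normc expr0n add0r sqrtr_sqr.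
  rewrite ger0_norm //; have := norm_sub HN (star U) U; rewrite hnorm_star_eq.
  by lra.
exists (k \c M); last first.
  by apply: le_trans (hnormM _ _) _; rewrite ler_wpM2l // hnorm_ge0.
rewrite addrC -uv /M -!compA (compA a) au comp1m.
have -> : k \c v = v \c k.
  by rewrite /v compBr compBl compZr compZl comp1m compm1.
by rewrite (compA b) bv comp1m.
Qed.

(* Multiplication by the element [w] of [cayley_bound] turns a witness for [k]
   into one of at most half the norm for [k ^ 2]. *)
Lemma witness_growth (n : nat) (k G : A) : star k = k -> hnorm k = 1 ->
  G \c (one - k \c k) = k \c k -> 2 ^+ n <= 2 * hnorm G.
Proof.
elim: n k G => [|n IH] k G sk k1 hG.
  have k21 : hnorm (k \c k) = 1 by rewrite -{1}sk hnormC k1 expr1n.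
  have := hnormM G (one - k \c k); rewrite hG k21.
  have := norm_sub HN one (k \c k); rewrite k21.
  by have := hnorm1 x; have := hnorm_ge0 G; rewrite expr0; nra.
have [w hw wle] := cayley_bound sk.
have sk2 : star (k \c k) = k \c k by rewrite star_comp sk.
have k21 : hnorm (k \c k) = 1 by rewrite -{1}sk hnormC k1 expr1n.
have := IH (k \c k) (w \c G) sk2 k21.
have -> : one - k \c k \c (k \c k) = (one - k \c k) \c (one + k \c k).
  by rewrite compBl !compDr !comp1m compm1 opprD addrA addrK.
rewrite -compA (compA G) hG => H.
have {}H : 2 ^+ n <= 2 * hnorm (w \c G).
  apply: H; rewrite compDr compm1 -[X in X + _]comp1m -compDl.
  by rewrite compA hw.
have := hnormM w G; have := hnorm_ge0 G; rewrite k1 in wle *.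
by rewrite exprS; nra.
Qed.

(** A left inverse [L] would make [G = k^2 L] satisfy the hypothesis of [witness_growth], hence
    [2^n <= 2 |G|] for all [n]. *)
Lemma norm_in_spectrum (k L : A) : star k = k -> hnorm k = 1 ->
  L \c (one - k \c k) <> one.
Proof.
move=> sk k1 hL; pose G := k \c k \c L.
have hG : G \c (one - k \c k) = k \c k by rewrite -compA hL compm1.
have [n hn] : exists n, 2 * hnorm G < n%:R.
  by exists (Num.bound (2 * hnorm G)); rewrite archi_boundP //
     mulr_ge0 ?hnorm_ge0.
have := witness_growth n sk k1 hG.
have : n%:R <= 2 ^+ n :> R by rewrite -natrX ler_nat ltnW // ltn_expl.
by lra.
Qed.

(** If [nu = |1 - k^2| > 1], then [h = (1 - k^2) / nu] has norm 1, while
    [nu (1 - h) = k^2 + (nu - 1)] and [nu (1 + h) = (nu + 1) - k^2] have left inverses, by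
    [arens_square] and by the Neumann series. So has [1 - h^2], against [norm_in_spectrum]. *)
Lemma norm_one_sub_square (k : A) : star k = k -> hnorm k <= 1 ->
  hnorm (one - k \c k) <= 1.
Proof.
move=> sk k1; rewrite leNgt; apply/negP; set nu := hnorm _ => nu1.
have nu0 : 0 < nu by lra.
have nu_n0 : nu != 0 by rewrite gt_eqF.
have nuC : nu%:C * (nu^-1)%:C = 1 by rewrite -rmorphM mulfV.
pose h := (nu^-1)%:C *: (one - k \c k).
have sh : star h = h.
  by rewrite starZr starD starN star1 star_comp sk.
have h1 : hnorm h = 1.
  by rewrite norm_scaler ?invr_ge0 ?(ltW nu0) // mulVf.
have nuh : nu%:C *: h = one - k \c k by rewrite /h scalerA nuC scale1r.
have [|b hb] := @arens_square k (nu - 1) sk; first lra.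
have [|b' hb'] := @neumann (nu + 1)%:C (k \c k).
  rewrite normcR ger0_norm; last lra.
  by have := hnormM k k; have := hnorm_ge0 k; nra.
apply: (@norm_in_spectrum h ((nu ^+ 2)%:C *: (b' \c b)) sh h1).
have hm : nu%:C *: (one - h) = k \c k + (nu - 1)%:C *: one.
  rewrite scalerBr nuh rmorphB /= scalerBl scale1r opprB addrCA.
  by rewrite addrA addrC addrA.
have hp : nu%:C *: (one + h) = (nu + 1)%:C *: one - k \c k.
  by rewrite scalerDr nuh rmorphD /= scalerDl scale1r addrA.
have -> : one - h \c h = (one - h) \c (one + h).
  by rewrite compBl !compDr !comp1m compm1 opprD addrA addrK.
have -> : (nu ^+ 2)%:C *: (b' \c b) \c ((one - h) \c (one + h)) =
    b' \c (b \c (nu%:C *: (one - h))) \c (nu%:C *: (one + h)).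
  by rewrite !compZr !compZl !compA scalerA -rmorphM.
by rewrite hm hb compm1 hp hb'.
Qed.

(** The equation says that [1 - w] is a square root of [1 - z]. The map [T] need not be a strict
    contraction of the unit ball; convergence comes from the scalar iteration [r], with [z] replaced
    by 1, whose increments dominate those of [u]. Each [u n] commutes with whatever commutes with
    [z], and so does the limit. *)
Lemma sqrt_fixpoint (z : A) : hnorm z <= 1 ->
  exists w : A, [/\ hnorm w <= 1, 2%:C *: w = z + w \c w &
    forall c : A, z \c c = c \c z -> w \c c = c \c w].
Proof.
move=> z1; pose T (b : A) := (2^-1)%:C *: (z + b \c b).
pose u n := iter n T (0 : A).
pose r n := iter n (fun t : R => (1 + t ^+ 2) / 2) 0.
have r01 n : 0 <= r n <= 1.
  by elim: n => [|n]; rewrite /= ?lexx //= -/(r n) => /andP[a b];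
     apply/andP; nra.
have TB b c : hnorm (T b - T c) <= (hnorm b + hnorm c) / 2 * hnorm (b - c).
  have -> : T b - T c = (2^-1)%:C *: (b \c (b - c) + (b - c) \c c).
    rewrite /T -scalerBr opprD addrACA subrr add0r compBr compBl.
    by rewrite addrA subrK.
  rewrite norm_scaler ?invr_ge0 //.
  have := norm_triangle HN (b \c (b - c)) ((b - c) \c c).
  by have := hnormM b (b - c); have := hnormM (b - c) c; lra.
have ur n : hnorm (u n) <= r n.
  elim: n => [|n IH]; first by rewrite (norm_0 HN).
  rewrite [u _]/= [r _]/= -/(u n) -/(r n) norm_scaler ?invr_ge0 //.
  have := norm_triangle HN z (u n \c u n); have := hnormM (u n) (u n).
  by have := hnorm_ge0 (u n); nra.
have du n : hnorm (u n.+1 - u n) <= r n.+1 - r n.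
  elim: n => [|n IH].
    by rewrite /= (subr0 (T 0)) subr0; exact: (ur 1%N).
  apply: le_trans (TB (u n.+1) (u n)) _.
  have -> : r n.+2 - r n.+1 = (r n.+1 + r n) / 2 * (r n.+1 - r n).
    by rewrite [r n.+2]/= [r n.+1 in RHS]/= -/(r n) [r n.+1]/= -/(r n); field.
  apply: ler_pM => //; rewrite ?divr_ge0 ?addr_ge0 ?hnorm_ge0 //.
  by rewrite ler_pM2r ?invr_gt0 // lerD.
have [|w uw] := norm_complete HN (u := u).
  by exists r, 1; split => // n; have /andP[] := r01 n.
have w1 : hnorm w <= 1.
  apply: (seq_limit_bound HN uw) => n; apply: le_trans (ur n) _.
  by have /andP[] := r01 n.
exists w; split => //.
  have Tw : T w = w.
    apply: (fixpoint_of_limit HN (u := u)) => // n; apply: le_trans (TB _ _) _.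
    have := hnorm_ge0 (u n - w); have := ur n; have /andP[_] := r01 n; nra.
  by rewrite -{1}Tw /T scalerA -rmorphM /= mulfV ?pnatr_eq0 // scale1r.
move=> c zc; apply/eqP; rewrite -subr_eq0; apply/eqP.
apply: (norm_small HN) => e e0.
have c0 := hnorm_ge0 c.
(* The commutator of [w] and [c] is at most [2 |c| |u n - w|]; the added 1 keeps the denominator
   positive when [c = 0]. *)
have d0 : 0 < e / (2 * (hnorm c + 1)) by rewrite divr_gt0 //; lra.
have [n /(_ _ (leqnn n)) uwn] := uw _ d0.
have uc : u n \c c = c \c u n.
  elim: n {uwn} => [|n IH]; first by rewrite /u /= comp0l comp0r.
  rewrite [u _]/= -/(u n) /T compZl compZr compDl compDr zc.
  by rewrite -compA IH !compA IH.
have -> : w \c c - c \c w = c \c (u n - w) - (u n - w) \c c.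
  by rewrite compBr compBl uc opprD opprK addrACA subrr add0r addrC.
have := norm_sub HN (c \c (u n - w)) ((u n - w) \c c).
have := hnormM c (u n - w); have := hnormM (u n - w) c.
have de : e / (2 * (hnorm c + 1)) * (2 * (hnorm c + 1)) = e.
  by rewrite divfK // gt_eqF //; lra.
move: uwn d0 de; set d := _ / _; set m := hnorm (u n - w).
have := hnorm_ge0 (u n - w); rewrite -/m; nra.
Qed.

End CstarAlgebra.

(** * Injective star functors are isometric *)

Section Isometry.
Variables (R : realType) (C D : cstarCat R) (F : starFunctor C D).
Local Notation "t \c s" := (comp t s) (at level 40, left associativity).

Lemma fmapD x y (s t : hom C x y) : fmap F (s + t) = fmap F s + fmap F t.
Proof. by have := fmap_linear F 1 s t; rewrite !scale1r. Qed.

Lemma fmap0 x y : fmap F (0 : hom C x y) = 0.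
Proof. by apply: (addrI (fmap F 0)); rewrite -fmapD !addr0. Qed.

Lemma fmapZ x y c (t : hom C x y) : fmap F (c *: t) = c *: fmap F t.
Proof. by have := fmap_linear F c t 0; rewrite fmap0 !addr0. Qed.

Lemma fmapB x y (s t : hom C x y) : fmap F (s - t) = fmap F s - fmap F t.
Proof. by rewrite fmapD -scaleN1r fmapZ scaleN1r. Qed.

Lemma fmap_contractive_sa x (h : hom C x x) : star h = h ->
  hnorm (fmap F h) <= hnorm h.
Proof.
move=> sh; rewrite leNgt; apply/negP => lt.
have r0 : 0 < hnorm (fmap F h) by apply: le_lt_trans lt; exact: hnorm_ge0.
set r := hnorm (fmap F h) in lt r0.
pose k := (r^-1)%:C *: h.
have k1 : hnorm k < 1.
  by rewrite (norm_scaler (hnorm_axioms _ _)) ?invr_ge0 ?(ltW r0) // mulrC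
     ltr_pdivrMr // mul1r.
have [|b hb] := @neumann1 _ _ _ (k \c k).
  by have := hnormM k k; have := hnorm_ge0 k; nra.
apply: (@norm_in_spectrum _ _ _ (fmap F k) (fmap F b)).
- by rewrite -fmap_star starZr sh.
- by rewrite fmapZ (norm_scaler (hnorm_axioms _ _)) ?invr_ge0 ?(ltW r0) //
     mulVf ?gt_eqF.
- by rewrite -!fmap_comp -fmap1 -fmapB -fmap_comp hb.
Qed.

Lemma fmap_contractive x y (t : hom C x y) : hnorm (fmap F t) <= hnorm t.
Proof.
have st : star (star t \c t) = star t \c t by rewrite star_comp starK.
have := fmap_contractive_sa st; rewrite fmap_comp fmap_star !hnormC.
by rewrite ler_pXn2r ?nnegrE ?hnorm_ge0.
Qed.

Hypothesis Finj : is_embedding F.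

Lemma fmap_isometric_sa x (h : hom C x x) : star h = h -> hnorm h = 1 ->
  1 <= hnorm (fmap F h).
Proof.
move=> sh h1; rewrite leNgt; apply/negP => Fh1.
have HC := hnorm_axioms x x; have HD := hnorm_axioms (F x) (F x).
set one := (idm x : hom C x x).
pose p := h \c h; pose r := hnorm (fmap F p).
have sp : star p = p by rewrite star_comp sh.
have p1 : hnorm p <= 1 by have := hnormM h h; rewrite h1 mulr1.
have r0 : 0 <= r by exact: hnorm_ge0.
have r1 : r < 1.
  rewrite /r fmap_comp; have := hnormM (fmap F h) (fmap F h).
  by have := hnorm_ge0 (fmap F h); nra.
(* Here [r < s] will make [F (y - x0)] left invertible, and [s < 1] will do so for [1 - p]. *)
pose s := (1 + r) / 2.
pose x0 := (2^-1)%:C *: (p - s%:C *: one).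
have sx0 : star x0 = x0 by rewrite starZr starD starN starZr star1 sp.
have x01 : hnorm x0 <= 1.
  rewrite (norm_scaler HC) ?invr_ge0 //; have := norm_sub HC p (s%:C *: one).
  rewrite (norm_scaler HC); last by rewrite /s; lra.
  by have := hnorm1 x; have := hnorm_ge0 one; rewrite /s -/one; nra.
have [w [w1 ww wc]] := sqrt_fixpoint (norm_one_sub_square sx0 x01).
pose y := one - w.
have xw : w \c x0 = x0 \c w.
  by apply: wc; rewrite compBl compBr comp1m compm1 compA.
(* The equation for [w] with [z = 1 - x0^2] gives [y^2 = x0^2], and [y] commutes with [x0]. *)
have yx : (y - x0) \c (y + x0) = 0.
  have xy : x0 \c y = y \c x0 by rewrite /y compBl compBr comp1m compm1 xw.
  have yy : y \c y = x0 \c x0.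
    rewrite /y compBl !compBr !comp1m compm1 opprB addrCA -addrA -opprD addrC.
    rewrite -[w in - (w + _)]scale1r -[w in - (_ + w)]scale1r -scalerDl.
    have -> : 1 + 1 = 2%:C :> R[i] by complex_ring.
    by rewrite ww opprD addrA subrK opprB addrC subrK.
  by rewrite compBl (compDr y y) (compDr x0 y) xy yy [X in _ - X]addrC subrr.
(* This inverts [F (y - x0) = (1 + s/2) - F (w + p/2)], since
   [|F (w + p/2)| <= 1 + r/2 < 1 + s/2]. *)
have [|b hb] := @neumann _ _ _ (1 + s / 2)%:C (fmap F (w + (2^-1)%:C *: p)).
  rewrite normcR ger0_norm; last by rewrite /s; lra.
  rewrite fmapD fmapZ; apply: le_lt_trans (norm_triangle HD _ _) _.
  rewrite (norm_scaler HD) ?invr_ge0 // -/r.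
  by have := fmap_contractive w; rewrite /s; lra.
have yx0 : y - x0 = (1 + s / 2)%:C *: one - (w + (2^-1)%:C *: p).
  rewrite /y /x0 scalerBr scalerA -rmorphM /= (mulrC _ s) rmorphD /= scalerDl.
  by rewrite scale1r opprB opprD addrACA.
have : y + x0 = 0.
  apply: Finj; rewrite fmap0 -[LHS]comp1m -hb -fmap1 -fmapZ -fmapB -yx0.
  by rewrite -compA -fmap_comp yx fmap0 comp0r.
move=> /eqP; rewrite addr_eq0 => /eqP yN.
have wE : w = one + x0 by rewrite -[x0]opprK -yN /y opprB addrC subrK.
(* As [w = 1 + x0], one has [1 - p = (3 - s) - 2 w], with [|2 w| <= 2 < 3 - s]. *)
have [|b' hb'] := @neumann _ _ _ (3 - s)%:C (2%:C *: w).
  rewrite normcR ger0_norm; last by rewrite /s; lra.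
  by rewrite (norm_scaler HC) //; rewrite /s; lra.
apply: (@norm_in_spectrum _ _ _ h b' sh h1); rewrite -[RHS]hb'; congr (_ \c _).
rewrite wE scalerDr /x0 scalerA -rmorphM /= mulfV ?pnatr_eq0 // scale1r.
have -> : (3 - s)%:C = 1 + 2%:C - s%:C :> R[i] by complex_ring.
rewrite scalerBl scalerDl scale1r -/one -/p.
by rewrite opprD opprB (addrAC one) addrA addrK addrA subrK.
Qed.

Lemma fmap_isometric x y (t : hom C x y) : hnorm (fmap F t) = hnorm t.
Proof.
apply/eqP; rewrite eq_le fmap_contractive /=.
rewrite -(@ler_pXn2r _ 2) ?nnegrE ?hnorm_ge0 // -!hnormC -fmap_star -fmap_comp.
set h := star t \c t; have sh : star h = h by rewrite star_comp starK.
have [h0|h_n0] := eqVneq (hnorm h) 0; first by rewrite h0 hnorm_ge0.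
have h_gt0 : 0 < hnorm h by rewrite lt_def h_n0 hnorm_ge0.
have := @fmap_isometric_sa _ (((hnorm h)^-1)%:C *: h).
rewrite starZr sh fmapZ !(norm_scaler (hnorm_axioms _ _));
  rewrite ?invr_ge0 ?hnorm_ge0 //.
by rewrite mulVf // mulrC ler_pdivlMr // mul1r; exact.
Qed.

End Isometry.

(** * The section category *)

(** Both faces of a triple lie below its support, so [phi] agrees on them, and then along a path. *)
Lemma path_constant (d : Order.disp_t) (K : porderType d) (T : Type)
    (phi : K -> T) :
  pathwise_connected K -> (forall o o', (o <= o')%O -> phi o' = phi o) ->
  forall o o', phi o = phi o'.
Proof.
move=> hK phi_le o o'; have [p] := hK o o'.
elim: p o => [|b p IH] o /= => [-> //|[<- /IH <-]].
by rewrite -(phi_le _ _ (face0_le b)) -(phi_le _ _ (face1_le b)).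
Qed.

Section SectionCstar.
Variables (R : realType) (d : Order.disp_t) (K : porderType d).
Hypothesis hK : pathwise_connected K.
Variable C : presheaf R K.

Lemma sec_hnorm_constant (x y : sec_obj C) (t : sec_hom x y) (o o' : K) :
  hnorm (t o) = hnorm (t o').
Proof.
apply: (path_constant (phi := fun o => hnorm (t o))) => // a b h.
have := f_equal (fun u : arrow (C a) => hnorm (arr u)) (sh_res t h).
by rewrite /= => <-; rewrite (fmap_isometric (@res_emb _ _ _ C a b h)).
Qed.

Lemma sec_normE (x y : sec_obj C) (t : sec_hom x y) (o : K) :
  sec_norm t = hnorm (t o).
Proof.
rewrite /sec_norm.
have -> : [set hnorm (t o') | o' in [set: K]] = [set hnorm (t o)].
  apply/seteqP; split=> [_ [o' _ <-]|_ ->]; first exact: sec_hnorm_constant.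
  by exists o.
exact: sup1.
Qed.

(** The empty poset is pathwise connected, so this case has to be treated; the supremum is then over
    the empty set. *)
Lemma sec_norm_empty (x y : sec_obj C) (t : sec_hom x y) :
  ~ inhabited K -> sec_norm t = 0.
Proof.
move=> K0; rewrite /sec_norm.
suff -> : [set hnorm (t o) | o in [set: K]] = set0 by rewrite sup0.
by apply/seteqP; split=> // r [o]; case: K0.
Qed.

Lemma sec_norm_axioms (x y : sec_obj C) :
  norm_axioms (fun t : sec_hom x y => sec_norm t).
Proof.
have HN o := hnorm_axioms (x o) (y o).
have [[o]|K0] := pselect (inhabited K); last first.
  split=> [u v|c v|v _|u _]; rewrite ?sec_norm_empty ?mulr0 ?addr0 //.
    by apply: sec_homP => o; case: K0.
  by exists 0 => e e0; exists 0%N => n _; rewrite sec_norm_empty // ltW.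
split=> [u v|c v|v|u [v [M [uv vM]]]].
- by rewrite !(sec_normE _ o) sec_addE; exact: norm_triangle.
- by rewrite !(sec_normE _ o) sec_scaleE; exact: norm_scale.
- move=> v0; apply: sec_homP => o'; apply: (norm_eq0 (HN o')).
  by rewrite -sec_normE.
have subE (s t : sec_hom x y) a : (s - t) a = s a - t a.
  by rewrite sec_addE -scaleN1r sec_scaleE scaleN1r.
(* One [v] serves all fibres, because the norm of a section is its norm in each fibre; limits can
   thus be taken fibrewise. *)
have bv a : bounded_variation (fun t => hnorm t) (fun n => u n a).
  by exists v, M; split=> // n; rewrite -subE -sec_normE.
pose l a := projT1 (cid (norm_complete (HN a) (bv a))).
have lP a : seq_limit (fun t => hnorm t) (fun n => u n a) (l a).
  by rewrite /l; case: cid.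
have l_res (a b : K) (h : (a <= b)%O) :
    Arrow (fmap (res C h) (l b)) = Arrow (l a).
  have [ex ey] := (so_res x h, so_res y h).
  (* The restricted endpoints equal [x a] and [y a] only provably. With variables in their place the
     equations can be eliminated, and isometry of the restriction makes both sides limits of one
     sequence. *)
  have : forall (x' y' : C a)
    (ex : res C h (x b) = x') (ey : res C h (y b) = y')
    (w : nat -> hom (C a) x' y') (m : hom (C a) x' y'),
    (forall n, Arrow (fmap (res C h) (u n b)) = Arrow (w n)) ->
    seq_limit (fun t => hnorm t) w m ->
    Arrow (fmap (res C h) (l b)) = Arrow m.
    move=> x' y' {}ex {}ey; case: x' / ex; case: y' / ey => w m uw wm.
    congr Arrow; apply: (seq_limit_unique (hnorm_axioms _ _) (u := w)) => //.
    move=> e /(lP b)[n0 h0]; exists n0 => n /h0.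
    rewrite -(Arrow_inj (uw n)) -(fmap_isometric (@res_emb _ _ _ C a b h)).
    by rewrite fmapB.
  apply; [exact: ex | exact: ey | | exact: lP].
  by move=> n; exact: sh_res.
exists (SecHom l_res) => e /(lP o)[n0 h0]; exists n0 => n /h0.
by rewrite (sec_normE _ o) subE.
Qed.

Lemma section_Cstar : is_Cstar (section_cat C).
Proof.
split=> [x y|x y z t s|x y t].
- exact/axioms_banach_norm/sec_norm_axioms.
- have [[o]|K0] := pselect (inhabited K).
    by rewrite /hnorm /= !(sec_normE _ o); exact: hnormM.
  by rewrite /hnorm /= !sec_norm_empty // mul0r.
- have [[o]|K0] := pselect (inhabited K).
    by rewrite /hnorm /= !(sec_normE _ o); exact: hnormC.
  by rewrite /hnorm /= !sec_norm_empty // expr0n.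
Qed.

Definition section_cstar : cstarCat R := CstarCat section_Cstar.

End SectionCstar.

(** * The presheaf bundle *)

Lemma bijective_of_surjective (T U : Type) (g : T -> U) :
  injective g -> (forall u, exists t, g t = u) -> bijective g.
Proof.
move=> g_inj /choice[h hK]; exists h => // t.
by apply: g_inj; rewrite hK.
Qed.

Section Evaluation.
Variables (R : realType) (d : Order.disp_t) (K : porderType d).
Variable C : presheaf R K.

Definition evaluation (o : K) : starFunctor (section_cat C) (C o) :=
  @StarFunctor R (section_cat C) (C o) (fun x : sec_obj C => x o)
    (fun x y (t : sec_hom x y) => t o) (fun _ => erefl)
    (fun _ _ _ _ _ => erefl) (fun x y a s t => sec_linE a s t o)
    (fun _ _ _ => erefl).

Lemma sec_objP (x y : sec_obj C) : (forall o, x o = y o) -> x = y.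
Proof.
case: x y => [x hx] [y hy] /= e.
have {}e : x = y by apply: functional_extensionality_dep.
by case: y / e hy => hy; rewrite (Prop_irrelevance hx hy).
Qed.

Lemma sec_arrowP (a b : arrow (section_cat C)) :
  (forall o, amap (evaluation o) a = amap (evaluation o) b) -> a = b.
Proof.
case: a b => [x y t] [x' y' t'] e.
have ex : x = x' by apply: sec_objP => o; exact: (f_equal (@src _ _) (e o)).
have ey : y = y' by apply: sec_objP => o; exact: (f_equal (@tgt _ _) (e o)).
case: x' / ex t' e => t' e; case: y' / ey t' e => t' e.
by congr Arrow; apply: sec_homP => o; exact: (Arrow_inj (e o)).
Qed.

Lemma evaluation_res (o o' : K) (h : (o <= o')%O) :
  eq_functor (compF (res C h) (evaluation o')) (evaluation o).
Proof. by split=> [x|[x y t]]; [exact: so_res | exact: sh_res]. Qed.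

Lemma sec_arrow_exists (al : forall o, arrow (C o)) :
  (forall o o' (h : (o <= o')%O), amap (res C h) (al o') = al o) ->
  exists a : arrow (section_cat C), forall o, amap (evaluation o) a = al o.
Proof.
move=> al_res.
have src_res o o' (h : (o <= o')%O) : res C h (src (al o')) = src (al o).
  by rewrite -(al_res _ _ h).
have tgt_res o o' (h : (o <= o')%O) : res C h (tgt (al o')) = tgt (al o).
  by rewrite -(al_res _ _ h).
have arr_res o o' (h : (o <= o')%O) :
    Arrow (fmap (res C h) (arr (al o'))) = Arrow (arr (al o)).
  by have := al_res _ _ h; case: (al o).
exists (@Arrow _ (section_cat C) (SecObj src_res) (SecObj tgt_res)
         (@SecHom _ _ _ _ (SecObj src_res) (SecObj tgt_res) _ arr_res)).
by move=> o; rewrite /amap /=; case: (al o).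
Qed.

End Evaluation.

Section ConstantPresheaf.
Variables (R : realType) (d : Order.disp_t) (K : porderType d).
Hypothesis hK : pathwise_connected K.
Variable C : presheaf R K.

(** Connectedness enters here already: through [section_cstar] it makes the fibre a C*-category. *)
Definition constant_presheaf : presheaf R K :=
  @Presheaf R d K (fun _ => section_cstar hK C) (fun _ _ _ => idF _)
    (fun _ _ _ _ _ _ _ e => e)
    (fun _ _ _ _ _ _ => conj (fun _ => erefl) (fun a => erefl)).

Lemma constant_presheaf_bundle : is_bundle constant_presheaf.
Proof. by move=> o o' h; split; exists id => // -[]. Qed.

Definition evaluation_mor : presheaf_mor constant_presheaf C :=
  @PresheafMor R d K constant_presheaf C (@evaluation R d K C)
    (fun o o' h => evaluation_res C h).

(** The functor sends a family [Z] of sections to its diagonal [o |-> Z o o]. Families are constant,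
    so the diagonal determines [Z], and a section is the diagonal of the constant family on it. *)
Lemma evaluation_mor_iso : is_isomorphism (section_functor evaluation_mor).
Proof.
split; apply: bijective_of_surjective.
- move=> X Y XY; apply: sec_objP => o; apply: sec_objP => o'.
  have cst (Z : sec_obj constant_presheaf) : Z o = Z o'.
    apply: (path_constant (phi := fun o => Z o : sec_obj C)) => // a b h.
    exact: (so_res Z h).
  by rewrite !cst; exact: (f_equal (fun x : sec_obj C => x o') XY).
- move=> x.
  have cst (o o' : K) (h : (o <= o')%O) : res constant_presheaf h x = x by [].
  by exists (SecObj cst); apply: sec_objP.
- move=> a b ab; apply: sec_arrowP => o; apply: sec_arrowP => o'.
  have cst (c : arrow (section_cat constant_presheaf)) :
      amap (evaluation constant_presheaf o) c =
      amap (evaluation constant_presheaf o') c.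
    apply: (path_constant (phi := fun o =>
      amap (evaluation constant_presheaf o) c : arrow (section_cat C))) =>
      // u v h.
    exact: ((evaluation_res constant_presheaf h).2 c).
  by rewrite !cst; exact: (f_equal (amap (evaluation C o')) ab).
- move=> b.
  have [|a ha] := @sec_arrow_exists _ _ _ constant_presheaf (fun _ => b).
    by case: b.
  exists a; apply: sec_arrowP => o.
  by rewrite -[in RHS](ha o); case: a {ha}.
Qed.

End ConstantPresheaf.

(** The value at [l] is specified against all proofs of [f o = l] at once; at [l = f o] the
    reflexivity proof then removes the cast. *)
Lemma bijective_transport (K L : Type) (f : K -> L) (T : L -> Type)
    (v : forall o, T (f o)) :
  bijective f -> {u : forall l, T l | forall o, u (f o) = v o}.
Proof.
move=> f_bij; have f_inj := bij_inj f_bij.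
have H l : exists w : T l, forall o (e : f o = l), ecast l (T l) e (v o) = w.
  have [g _ fK] := f_bij; rewrite -(fK l); move: (g l) => o0.
  exists (v o0) => o e.
  case: _ / (f_inj _ _ e) (e) => {}e.
  by rewrite (Prop_irrelevance e erefl).
exists (fun l => projT1 (cid (H l))) => o.
by case: cid => w /= wP; rewrite -(wP o erefl).
Qed.

Lemma arrow_cast (R : realType) (C : starCat R) (a : arrow C) (x y : C) :
  src a = x -> tgt a = y -> {t : hom C x y | Arrow t = a}.
Proof. by case: a => x' y' t /= <- <-; exists t. Qed.

(** * Action of presheaf isomorphisms on section categories *)

Section Pushforward.
Variables (R : realType) (d d' : Order.disp_t).
Variables (K : porderType d) (L : porderType d').
Variables (f : K -> L) (hf : order_isomorphism f).
Variables (C : presheaf R K) (D : presheaf R L) (F : presheaf_iso f C D).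

Let f_bij : bijective f := hf.1.

Lemma order_iso_lift (l l' : L) : (l <= l')%O ->
  exists o o' : K, [/\ f o = l, f o' = l' & (o <= o')%O].
Proof.
have [g gK fK] := f_bij => ll'; exists (g l), (g l').
by rewrite !fK; split => //; rewrite -hf.2 !fK.
Qed.

Lemma push_obj_exists (x : sec_obj C) :
  {y : sec_obj D | forall o, y (f o) = F o (x o)}.
Proof.
have [y yP] :=
  bijective_transport (T := fun l => D l) (fun o => F o (x o)) f_bij.
suff y_res l l' (h : (l <= l')%O) : res D h (y l') = y l.
  by exists (SecObj y_res).
have [o [o' [eo eo' oo']]] := order_iso_lift h.
case: _ / eo h => h; case: _ / eo' h => h; rewrite !yP.
have [/(_ (x o')) /= -> _] := piso_res F oo' h.
by rewrite so_res.
Qed.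

Definition push_obj (x : sec_obj C) : sec_obj D := projT1 (push_obj_exists x).

Lemma push_objE (x : sec_obj C) o : push_obj x (f o) = F o (x o).
Proof. exact: (projT2 (push_obj_exists x)). Qed.

Lemma push_hom_exists (x y : sec_obj C) (t : sec_hom x y) :
  {s : sec_hom (push_obj x) (push_obj y) |
    forall o, Arrow (s (f o)) = Arrow (fmap (F o) (t o))}.
Proof.
(* The endpoints of the pushed sections at [f o] are only provably those of [fmap (F o) (t o)]. *)
pose v o := arrow_cast (a := Arrow (fmap (F o) (t o)))
  (esym (push_objE x o)) (esym (push_objE y o)).
have [s sP] := bijective_transport
  (T := fun l => hom (D l) (push_obj x l) (push_obj y l))
  (fun o => projT1 (v o)) f_bij.
have {}sP o : Arrow (s (f o)) = Arrow (fmap (F o) (t o)).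
  by rewrite sP (projT2 (v o)).
suff s_res l l' (h : (l <= l')%O) : Arrow (fmap (res D h) (s l')) = Arrow (s l).
  by exists (SecHom s_res).
have [o [o' [eo eo' oo']]] := order_iso_lift h.
case: _ / eo h => h; case: _ / eo' h => h.
rewrite sP -[LHS]/(amap (res D h) (Arrow (s (f o')))) sP.
apply: etrans ((piso_res F oo' h).2 (Arrow (t o'))) _.
exact: (f_equal (amap (F o)) (sh_res t oo')).
Qed.

Definition push_hom (x y : sec_obj C) (t : sec_hom x y) :=
  projT1 (push_hom_exists t).

Lemma push_homE (x y : sec_obj C) (t : sec_hom x y) o :
  Arrow (push_hom t (f o)) = Arrow (fmap (F o) (t o)).
Proof. exact: (projT2 (push_hom_exists t)). Qed.

Lemma push_homP (x y : sec_obj D) (s t : sec_hom x y) :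
  (forall o, Arrow (s (f o)) = Arrow (t (f o))) -> s = t.
Proof.
move=> st; apply: sec_homP => l; have [g _ fK] := f_bij.
by rewrite -(fK l); exact: Arrow_inj.
Qed.

Lemma push_hom1 (x : sec_obj C) : push_hom (sec_id x) = sec_id (push_obj x).
Proof.
apply: push_homP => o; rewrite push_homE /= fmap1.
by apply: Arrow_idm; rewrite push_objE.
Qed.

Lemma push_hom_comp (x y z : sec_obj C) (t : sec_hom y z) (s : sec_hom x y) :
  push_hom (sec_comp t s) = sec_comp (push_hom t) (push_hom s).
Proof.
apply: push_homP => o; rewrite push_homE /= fmap_comp.
by apply: Arrow_comp; rewrite ?push_objE ?push_homE.
Qed.

Lemma push_hom_linear (x y : sec_obj C) : linear (@push_hom x y).
Proof.
move=> a s t; apply: push_homP => o; rewrite push_homE !sec_linE fmap_linear.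
by apply: Arrow_lin; rewrite ?push_objE ?push_homE.
Qed.

Lemma push_hom_star (x y : sec_obj C) (t : sec_hom x y) :
  push_hom (sec_star t) = sec_star (push_hom t).
Proof.
apply: push_homP => o; rewrite push_homE /= fmap_star.
by apply: Arrow_star; rewrite push_homE.
Qed.

Definition pushforward : starFunctor (section_cat C) (section_cat D) :=
  @StarFunctor R (section_cat C) (section_cat D) push_obj push_hom
    push_hom1 push_hom_comp push_hom_linear push_hom_star.

Lemma pushforwardE (o : K) :
  eq_functor (compF (evaluation D (f o)) pushforward)
             (compF (F o) (evaluation C o)).
Proof. by split=> [x|[x y t]]; [exact: push_objE | exact: push_homE]. Qed.

Lemma pushforward_objP (x y : sec_obj D) :
  (forall o, x (f o) = y (f o)) -> x = y.
Proof.
by move=> xy; apply: sec_objP => l; have [g _ fK] := f_bij; rewrite -(fK l).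
Qed.

Lemma pushforward_arrowP (a b : arrow (section_cat D)) :
  (forall o, amap (evaluation D (f o)) a = amap (evaluation D (f o)) b) ->
  a = b.
Proof.
by move=> ab; apply: sec_arrowP => l; have [g _ fK] := f_bij; rewrite -(fK l).
Qed.

(** Fibrewise preimages under the bijections [F o] form a compatible family, because [F] commutes
    with restrictions and each [F o] is injective. *)
Lemma pushforward_iso : is_isomorphism pushforward.
Proof.
have [F_obj F_arr] : (forall o, bijective (fobj (F o))) /\
    (forall o, bijective (amap (F o))).
  by split=> o; have [] := piso_bij F o.
have [PO PA] : (forall o x, push_obj x (f o) = F o (x o)) /\
  (forall o a, amap (evaluation D (f o)) (amap pushforward a) =
     amap (F o) (amap (evaluation C o) a)).
  by split=> [o x|o]; [exact: push_objE | have [] := pushforwardE o].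
have f_mono o o' : (o <= o')%O -> (f o <= f o')%O by rewrite hf.2.
split; apply: bijective_of_surjective.
- move=> x y xy; apply: sec_objP => o; apply: (bij_inj (F_obj o)).
  by rewrite -!PO; exact: (f_equal (fun z : sec_obj D => z (f o)) xy).
- move=> y.
  have /= E o : exists c, F o c = y (f o).
    by have [g gK fK] := F_obj o; exists (g (y (f o))).
  pose x o := projT1 (cid (E o)).
  have xP o : F o (x o) = y (f o) by rewrite /x; case: cid.
  have x_res o o' (h : (o <= o')%O) : res C h (x o') = x o.
    apply: (bij_inj (F_obj o)); rewrite xP -(so_res y (f_mono _ _ h)) -xP.
    by have [/(_ (x o')) /= -> _] := piso_res F h (f_mono _ _ h).
  by exists (SecObj x_res); apply: pushforward_objP => o; rewrite /= PO.
- move=> a b ab; apply: sec_arrowP => o; apply: (bij_inj (F_arr o)).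
  by rewrite -!PA ab.
- move=> b.
  have /= E o : exists c, amap (F o) c = amap (evaluation D (f o)) b.
    by have [g gK fK] := F_arr o; exists (g (amap (evaluation D (f o)) b)).
  pose al o := projT1 (cid (E o)).
  have alP o : amap (F o) (al o) = amap (evaluation D (f o)) b.
    by rewrite /al; case: cid.
  have [|a aP] := @sec_arrow_exists _ _ _ C al.
    move=> o o' h; apply: (bij_inj (F_arr o)); rewrite alP.
    have [_ /(_ b) <-] := evaluation_res D (f_mono _ _ h).
    apply: etrans (esym ((piso_res F h (f_mono _ _ h)).2 (al o'))) _.
    exact: (f_equal (amap (res D (f_mono _ _ h))) (alP o')).
  by exists a; apply: pushforward_arrowP => o; rewrite PA aP alP.
Qed.

Section Constant.
Variables (hK : pathwise_connected K) (hL : pathwise_connected L).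

Definition pushforward_iso_presheaf :
    presheaf_iso f (constant_presheaf hK C) (constant_presheaf hL D) :=
  @PresheafIso R d d' K L f (constant_presheaf hK C) (constant_presheaf hL D)
    (fun _ => pushforward)
    (fun _ _ _ _ => conj (fun _ => erefl) (fun _ => erefl))
    (fun _ => pushforward_iso).

End Constant.

End Pushforward.

Lemma pushforward_id (R : realType) (d : Order.disp_t) (K : porderType d)
    (hid : order_isomorphism (@id K)) (C : presheaf R K)
    (F : presheaf_iso id C C) :
  (forall o : K, eq_functor (F o) (idF (C o))) ->
  eq_functor (pushforward hid F) (idF (section_cat C)).
Proof.
move=> F1; split=> [x|a].
  by apply: sec_objP => o; rewrite (push_objE hid F x o) (F1 o).1.
apply: sec_arrowP => o; have [_ /(_ a)] := pushforwardE hid F o.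
rewrite -[LHS]/(amap (evaluation C o) (amap (pushforward hid F) a)) => ->.
rewrite -[LHS]/(amap (F o) (amap (evaluation C o) a)) (F1 o).2.
by case: a.
Qed.

(** Both sides have the same evaluation at every [g (f o)], and these evaluations separate sections
    since [g \o f] is onto. *)
Lemma pushforward_comp (R : realType) (d1 d2 d3 : Order.disp_t)
    (K : porderType d1) (L : porderType d2) (M : porderType d3)
    (f : K -> L) (g : L -> M)
    (hf : order_isomorphism f) (hg : order_isomorphism g)
    (hgf : order_isomorphism (g \o f))
    (C : presheaf R K) (D : presheaf R L) (E : presheaf R M)
    (F : presheaf_iso f C D) (G : presheaf_iso g D E)
    (H : presheaf_iso (g \o f) C E) :
  (forall o : K, eq_functor (H o) (compF (G (f o)) (F o))) ->
  eq_functor (pushforward hgf H) (compF (pushforward hg G) (pushforward hf F)).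
Proof.
move=> HGF; split=> [x|a].
  apply: (pushforward_objP hgf) => o.
  rewrite (push_objE hgf H x o) (HGF o).1 /=.
  by rewrite (push_objE hg G _ (f o)) (push_objE hf F x o).
apply: (pushforward_arrowP hgf) => o.
have [_ /(_ a)] := pushforwardE hgf H o.
have [_ /(_ (amap (pushforward hf F) a))] := pushforwardE hg G (f o).
have [_ /(_ a)] := pushforwardE hf F o.
have := (HGF o).2 (amap (evaluation C o) a).
move=> e1 e2 e3 e4; apply: etrans e4 _; apply: etrans e1 _.
apply: etrans (esym e3).
exact: (f_equal (amap (G (f o))) (esym e2)).
Qed.

Definition constant_construction (R : realType) : canonical_construction R :=
  @CanonicalConstruction R
    (fun d K hK C => constant_presheaf hK C)
    (fun d K hK C => evaluation_mor hK C)
    (fun d d' K L hK hL f hf C D F => pushforward_iso_presheaf hf F hK hL)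
    (fun d d' K L hK hL f hf C D F o => pushforwardE hf F o)
    (fun d K hK hid C F F1 o => pushforward_id hid F1)
    (fun d1 d2 d3 K L M hK hL hM f g hf hg hgf C D E F G H HGF o =>
       pushforward_comp hf hg hgf HGF).

Theorem proposition3p4 (R : realType) :
  exists B : canonical_construction R,
    forall (d : Order.disp_t) (K : porderType d) (hK : pathwise_connected K)
      (C : presheaf R K),
      [/\ is_bundle (beta B hK C),
          is_Cstar (section_cat (beta B hK C)),
          is_Cstar (section_cat C) &
          is_isomorphism (section_functor (betaP B hK C))].
Proof.
exists (constant_construction R) => d K hK C; split.
- exact: constant_presheaf_bundle.
- exact: section_Cstar.
- exact: section_Cstar.
- exact: evaluation_mor_iso.
Qed.
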